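(* The group of all rational bilipschitz homeomorphisms of $\{0,1\}^\omega$ is simple but not finitely generated.
   Context: Let $\{0,1\}^\omega$ be the Cantor set of infinite binary sequences, with its standard metric (e.g. $d(\psi,\phi)=2^{-n}$ where $n$ is the length of the longest common prefix of $\psi\neq\phi$). An asynchronous binary transducer is a quadruple $(S,s_0,t,o)$ with $S$ a finite set of states, $s_0\in S$, $t\colon S\times\{0,1\}\to S$ and $o\colon S\times\{0,1\}\to\{0,1\}^*$ (finite binary words). For a state $s$ and a sequence $\sigma_1\sigma_2\cdots$, define $s_1=s$, $s_{n+1}=t(s_n,\sigma_n)$, and $o(s,\sigma_1\sigma_2\cdots)=o(s_1,\sigma_1)o(s_2,\sigma_2)\cdots$. A homeomorphism $f$ of $\{0,1\}^\omega$ is rational if some such transducer satisfies $f(\psi)=o(s_0,\psi)$ for all $\psi$. A homeomorphism is bilipschitz if it and its inverse are Lipschitz. *)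

(* Defs.v *)
From mathcomp Require Import all_boot.
From Stdlib Require Import Reals.

Set Implicit Arguments.
Unset Strict Implicit.
Unset Printing Implicit Defensive.

Definition Cantor := nat -> bool.

Definition agree (n : nat) (x y : Cantor) : Prop := forall i, (i < n)%N -> x i = y i.

Definition is_lcp (x y : Cantor) (n : nat) : Prop := agree n x y /\ x n <> y n.

Definition cdist (x y : Cantor) (r : R) : Prop :=
  (x = y /\ r = 0%R) \/ (exists n, is_lcp x y n /\ r = ((/ 2) ^ n)%R).

Definition lipschitz (f : Cantor -> Cantor) : Prop :=
  exists C : R, forall x y dxy dfxy,
    cdist x y dxy -> cdist (f x) (f y) dfxy -> (dfxy <= C * dxy)%R.

(* continuity w.r.t. the metric (balls are cylinder sets) *)
Definition ccontinuous (f : Cantor -> Cantor) : Prop :=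
  forall x (n : nat), exists m : nat, forall y, agree m x y -> agree n (f x) (f y).

Definition is_inverse (f g : Cantor -> Cantor) : Prop :=
  forall x, g (f x) = x /\ f (g x) = x.

Definition is_homeo (f : Cantor -> Cantor) : Prop :=
  ccontinuous f /\ exists g, is_inverse f g /\ ccontinuous g.

Definition bilipschitz (f : Cantor -> Cantor) : Prop :=
  lipschitz f /\ exists g, is_inverse f g /\ lipschitz g.

Record transducer := Transducer {
  tstate : finType;
  tinit : tstate;
  ttrans : tstate -> bool -> tstate;
  tout : tstate -> bool -> seq bool
}.

Fixpoint tstate_after (T : transducer) (s : tstate T) (x : Cantor) (n : nat) : tstate T :=
  match n with
  | 0 => s
  | n'.+1 => ttrans (tstate_after s x n') (x n')
  end.

Fixpoint tout_prefix (T : transducer) (s : tstate T) (x : Cantor) (n : nat) : seq bool :=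
  match n with
  | 0 => [::]
  | n'.+1 => tout_prefix s x n' ++ tout (tstate_after s x n') (x n')
  end.

Definition transducer_output (T : transducer) (s : tstate T) (x y : Cantor) : Prop :=
  (forall k : nat, exists n : nat, (k < size (tout_prefix s x n))%N) /\
  (forall n i : nat, (i < size (tout_prefix s x n))%N -> nth false (tout_prefix s x n) i = y i).

Definition rational_homeo (f : Cantor -> Cantor) : Prop :=
  is_homeo f /\ exists T : transducer, forall x, transducer_output (tinit T) x (f x).

Definition RBL (f : Cantor -> Cantor) : Prop := rational_homeo f /\ bilipschitz f.

Definition is_subgroup (H : (Cantor -> Cantor) -> Prop) : Prop :=
  (forall f, H f -> is_homeo f) /\
  H (fun x => x) /\
  (forall f g, H f -> H g -> H (fun x => f (g x))) /\
  (forall f g, H f -> is_inverse f g -> H g).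

Definition is_normal_subgroup_of (N G : (Cantor -> Cantor) -> Prop) : Prop :=
  is_subgroup N /\ (forall f, N f -> G f) /\
  (forall f h hi, N f -> G h -> is_inverse h hi -> N (fun x => h (f (hi x)))).

Definition simple_group (G : (Cantor -> Cantor) -> Prop) : Prop :=
  (exists f, G f /\ exists x, f x <> x) /\
  (forall N, is_normal_subgroup_of N G ->
     (forall f, N f -> forall x, f x = x) \/ (forall f, G f -> N f)).

Definition generated (L : seq (Cantor -> Cantor)) (f : Cantor -> Cantor) : Prop :=
  forall H, is_subgroup H -> (forall g, List.In g L -> H g) -> H f.

Definition finitely_generated (G : (Cantor -> Cantor) -> Prop) : Prop :=
  exists L : seq (Cantor -> Cantor),
    (forall g, List.In g L -> G g) /\ (forall f, G f -> generated L f).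

(* Main.v *)
Require Import Defs.
From mathcomp Require Import all_boot zify.
From Stdlib Require Import Reals Lra FunctionalExtensionality Classical.

(* A rational bilipschitz homeomorphism [f] is the same as a bijection such that
   [f] and its inverse delay digits by a bounded amount [c] and have finitely many
   local actions [z |-> f (u z)] with the first [|u| - c] digits dropped. In this
   form closure under composition, inversion and piecewise definition is direct.

   Simplicity: if a normal subgroup contains an [f] moving a cone [w] off itself,
   it contains all commutators supported on [w]. By an infinite swindle every
   element supported on the cone [10] is a commutator, all proper cones are
   equivalent under the group, and every element is a product of two elements
   each fixing some cone pointwise.

   Infinite generation: by pigeonhole on local actions, [f] multiplies the period
   of an eventually periodic sequence by at most the number of local actions. So
   finitely many elements preserve the set of sequences whose period has only
   prime factors [<= N], for some [N]; adding modulo 2 a sequence of prime period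
   [p > N] does not preserve it. *)

Set Implicit Arguments.
Unset Strict Implicit.
Unset Printing Implicit Defensive.

(** * Words and sequences *)

Definition shift (k : nat) (x : Cantor) : Cantor := fun i => x (k + i).

Definition prepend (u : seq bool) (x : Cantor) : Cantor :=
  fun i => if i < size u then nth false u i else x (i - size u).

Definition zeros : Cantor := fun _ => false.

Definition in_cone (u : seq bool) (x : Cantor) : bool := mkseq x (size u) == u.

Lemma shift0 x : shift 0 x = x.
Proof. by apply: functional_extensionality => i; rewrite /shift add0n. Qed.

Lemma shiftD k l x : shift k (shift l x) = shift (k + l) x.
Proof.
apply: functional_extensionality => i; rewrite /shift.
by congr (x _); lia.
Qed.

Lemma prepend_nil x : prepend [::] x = x.
Proof. by apply: functional_extensionality => i; rewrite /prepend /= subn0. Qed.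

Lemma prepend_cat u v x : prepend (u ++ v) x = prepend u (prepend v x).
Proof.
apply: functional_extensionality => i; rewrite /prepend size_cat nth_cat.
case: (ltnP i (size u)) => h; first by rewrite ltn_addr.
have -> : (i < size u + size v) = (i - size u < size v) by lia.
by case: ifP => // _; congr (x _); lia.
Qed.

Lemma prepend_lt u x i : i < size u -> prepend u x i = nth false u i.
Proof. by rewrite /prepend => ->. Qed.

Lemma prepend_ge u x i : prepend u x (size u + i) = x i.
Proof. by rewrite /prepend ltnNge leq_addr /= addKn. Qed.

Lemma shift_prepend k u x :
  shift k (prepend u x) = prepend (drop k u) (shift (k - size u) x).
Proof.
apply: functional_extensionality => i; rewrite /shift /prepend size_drop nth_drop.
have -> : (k + i < size u) = (i < size u - k) by lia.
by case: ifP => // /negbT h; congr (x _); lia.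
Qed.

Lemma shift_size_prepend u x : shift (size u) (prepend u x) = x.
Proof. by rewrite shift_prepend drop_size subnn shift0 prepend_nil. Qed.

Lemma prepend_mkseq n x : prepend (mkseq x n) (shift n x) = x.
Proof.
apply: functional_extensionality => i; rewrite /prepend /shift size_mkseq.
by case: ltnP => h; [rewrite nth_mkseq | rewrite subnKC].
Qed.

Lemma prepend_inj u : injective (prepend u).
Proof. by move=> x y e; rewrite -(shift_size_prepend u x) e shift_size_prepend. Qed.

Lemma in_cone_prepend u x : in_cone u (prepend u x).
Proof.
apply/eqP/(@eq_from_nth _ false); first by rewrite size_mkseq.
by move=> i; rewrite size_mkseq => h; rewrite nth_mkseq // prepend_lt.
Qed.

Lemma in_coneE u x : in_cone u x -> prepend u (shift (size u) x) = x.
Proof. by move/eqP=> h; rewrite -[in LHS]h size_mkseq prepend_mkseq. Qed.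

Lemma prepend_head x : prepend [:: x 0] (shift 1 x) = x.
Proof. exact: (prepend_mkseq 1). Qed.

Lemma agree_mkseq n x y : agree n x y <-> mkseq x n = mkseq y n.
Proof.
split=> [h | h i hi].
  apply: (@eq_from_nth _ false); rewrite !size_mkseq // => i hi.
  by rewrite !nth_mkseq // h.
by rewrite -(nth_mkseq false x hi) h nth_mkseq.
Qed.

Lemma agreeW m n x y : m <= n -> agree n x y -> agree m x y.
Proof. by move=> h a i hi; apply: a; apply: leq_trans hi h. Qed.

Lemma agree_prepend u x y : agree (size u) (prepend u x) (prepend u y).
Proof. by move=> i hi; rewrite !prepend_lt. Qed.

Lemma in_cone_agree u x y : agree (size u) x y -> in_cone u x = in_cone u y.
Proof. by rewrite agree_mkseq /in_cone => ->. Qed.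

(** * Functions of words with finitely many values *)

(** The values are often functions, so finiteness is stated through a label [q u] in a finite type
    that determines [P u]. *)
Definition finite_valued (A : Type) (P : seq bool -> A) : Prop :=
  exists (S : finType) (q : seq bool -> S), forall u v, q u = q v -> P u = P v.

Lemma finite_valued_fin (S : finType) (P : seq bool -> S) : finite_valued P.
Proof. by exists S, P. Qed.

Lemma finite_valued_map A B (g : A -> B) (P : seq bool -> A) :
  finite_valued P -> finite_valued (fun u => g (P u)).
Proof. by move=> [S [q h]]; exists S, q => u v /h ->. Qed.

Lemma finite_valued_map2 A B C (g : A -> B -> C) P Q :
  finite_valued P -> finite_valued Q -> finite_valued (fun u => g (P u) (Q u)).
Proof.
move=> [S [q h]] [S' [q' h']]; exists (S * S')%type, (fun u => (q u, q' u)).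
by move=> u v [/h -> /h' ->].
Qed.

Lemma finite_valued_precomp A (P : seq bool -> A) (k : seq bool -> seq bool) :
  finite_valued P -> finite_valued (fun u => P (k u)).
Proof. by move=> [S [q h]]; exists S, (fun u => q (k u)) => u v /h. Qed.

Lemma finite_valued_if A (b : seq bool -> bool) (P Q : seq bool -> A) :
  finite_valued P -> finite_valued Q ->
  finite_valued (fun u => if b u then P u else Q u).
Proof.
move=> hP hQ.
apply: (finite_valued_map2 (fun (b : bool) (x : A * A) => if b then x.1 else x.2)
  (P := b) (Q := fun u => (P u, Q u))); first exact: finite_valued_fin.
exact: (finite_valued_map2 pair).
Qed.

Lemma eq_finite_valued A (P Q : seq bool -> A) :
  (forall u, P u = Q u) -> finite_valued Q -> finite_valued P.
Proof. by move=> e [S [q h]]; exists S, q => u v /h; rewrite !e. Qed.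

Lemma finite_valued_nat (P : seq bool -> nat) K :
  (forall u, P u <= K) -> finite_valued P.
Proof.
move=> h; exists 'I_K.+1, (fun u => inord (P u)) => u v /(congr1 val).
by rewrite /= !inordK // ltnS.
Qed.

Lemma finite_valued_word (P : seq bool -> seq bool) K :
  (forall u, size (P u) <= K) -> finite_valued P.
Proof.
move=> h; exists (K.-bseq bool), (fun u => Bseq (h u)).
by move=> u v /(congr1 val).
Qed.

(** Only finitely many words are shorter than [n], so [P] may be arbitrary on them. *)
Lemma eventually_finite_valued A (P Q : seq bool -> A) n :
  (forall u, n <= size u -> P u = Q u) -> finite_valued Q -> finite_valued P.
Proof.
move=> e hQ.
apply: (@eq_finite_valued _ _ (fun u => if size u < n then P (take n u) else Q u)).
  by move=> u; case: ltnP => [h | /e //]; rewrite take_oversize // ltnW.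
apply: finite_valued_if => //; apply: finite_valued_map.
by apply: (@finite_valued_word _ n) => u; rewrite size_take; case: ltnP.
Qed.

(** * Finite-state maps *)

Definition delay (c : nat) (f : Cantor -> Cantor) : Prop :=
  forall n x y, agree n x y -> agree (n - c) (f x) (f y).

(* For [delay c f], the first [size u - c] digits of [f (prepend u z)] do not
   depend on [z]; the local action is what remains. *)
Definition local_action (c : nat) (f : Cantor -> Cantor) (u : seq bool) (z : Cantor) : Cantor :=
  shift (size u - c) (f (prepend u z)).

Definition finite_state (f : Cantor -> Cantor) : Prop :=
  exists2 c, delay c f & finite_valued (local_action c f).

Lemma delayW c c' f : c <= c' -> delay c f -> delay c' f.
Proof. by move=> h d n x y /d; apply: agreeW; lia. Qed.

Lemma delay_prepend c f u z z' : delay c f ->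
  f (prepend u z) = prepend (mkseq (f (prepend u z')) (size u - c)) (local_action c f u z).
Proof.
move=> d; rewrite -[LHS](prepend_mkseq (size u - c)); congr (prepend _ _).
by apply/agree_mkseq/d/agree_prepend.
Qed.

(** A larger allowance drops fewer digits: the new local action is the old one behind a word of at
    most [c'] digits. *)
Lemma finite_valued_delayW c c' f : c <= c' -> delay c f ->
  finite_valued (local_action c f) -> finite_valued (local_action c' f).
Proof.
move=> h d hf.
pose w u := drop (size u - c') (mkseq (f (prepend u zeros)) (size u - c)).
apply: (@eq_finite_valued _ _ (fun u z => prepend (w u) (local_action c f u z))).
  move=> u; apply: functional_extensionality => z.
  rewrite {1}/local_action (delay_prepend u z zeros d) shift_prepend size_mkseq.
  have -> : size u - c' - (size u - c) = 0 by lia.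
  by rewrite shift0.
apply: (finite_valued_map2 (fun w (k : Cantor -> Cantor) z => prepend w (k z))
  (P := w) (Q := local_action c f)) => //.
by apply: (@finite_valued_word _ c') => u; rewrite size_drop size_mkseq; lia.
Qed.

(** Having read [u], [g] has settled the word [p u], which [f] can then read; so the local action of
    the composite at [u] is that of [g] at [u] followed by that of [f] at [p u]. *)
Lemma finite_state_comp f g :
  finite_state f -> finite_state g -> finite_state (fun x => f (g x)).
Proof.
move=> [c df hf] [c' dg hg]; exists (c' + c).
  by move=> n x y /dg /df; rewrite subnDA.
pose p u := mkseq (g (prepend u zeros)) (size u - c').
apply: (@eq_finite_valued _ _ (fun u z => local_action c f (p u) (local_action c' g u z))).
  move=> u; apply: functional_extensionality => z.
  by rewrite {1}/local_action (delay_prepend u z zeros dg) subnDA /(local_action c f) size_mkseq.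
apply: (finite_valued_map2 (fun (k l : Cantor -> Cantor) z => k (l z))
  (P := fun u => local_action c f (p u)) (Q := local_action c' g)) => //.
exact: finite_valued_precomp.
Qed.

(** The test is settled after [n] digits; from then on the local action is that of the chosen
    branch. *)
Lemma finite_state_if (P : Cantor -> bool) n f g :
  (forall x y, agree n x y -> P x = P y) ->
  finite_state f -> finite_state g -> finite_state (fun x => if P x then f x else g x).
Proof.
move=> hP [c df hf] [c' dg hg]; pose d := n + (c + c').
have df' : delay d f by apply: delayW df; lia.
have dg' : delay d g by apply: delayW dg; lia.
exists d => [m x y a|].
  case: (leqP n m) => h; last by have -> : m - d = 0 by lia.
  by rewrite (hP x y (agreeW h a)); case: ifP => _; [apply: df' | apply: dg'].
apply: (@eventually_finite_valued _ _ (fun u => if P (prepend u zeros)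
  then local_action d f u else local_action d g u) n).
  move=> u hu; apply: functional_extensionality => z; rewrite /local_action.
  rewrite (hP _ (prepend u zeros)); last by apply: agreeW hu _; apply: agree_prepend.
  by case: ifP.
by apply: finite_valued_if; [apply: finite_valued_delayW df hf | apply: finite_valued_delayW dg hg]; lia.
Qed.

Lemma finite_state_prepend v : finite_state (prepend v).
Proof.
exists 0 => [n x y a i|].
  by rewrite subn0 /prepend => hi; case: ifP => // _; apply: a; lia.
(* The pending word consists of the last [size v] letters of [v ++ u]. *)
apply: (@eq_finite_valued _ _ (fun u => prepend (drop (size u) (v ++ u)))).
  move=> u; apply: functional_extensionality => z.
  rewrite /local_action subn0 -prepend_cat shift_prepend size_cat.
  have -> : size u - (size v + size u) = 0 by lia.
  by rewrite shift0.
apply: finite_valued_map; apply: (@finite_valued_word _ (size v)) => u.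
by rewrite size_drop size_cat; lia.
Qed.

Lemma finite_state_id : finite_state (fun x => x).
Proof.
have -> : (fun x : Cantor => x) = prepend [::]; last exact: finite_state_prepend.
by apply: functional_extensionality => x; rewrite prepend_nil.
Qed.

Lemma finite_state_shift k : finite_state (shift k).
Proof.
exists k => [n x y a i hi|]; first by apply: a; lia.
apply: (@eventually_finite_valued _ _ (fun _ z => z) k) => [u hu|].
  apply: functional_extensionality => z.
  by rewrite /local_action shiftD subnK // shift_size_prepend.
by exists unit, (fun _ => tt).
Qed.

Definition xor (y x : Cantor) : Cantor := fun i => y i (+) x i.

Lemma xorK y x : xor y (xor y x) = x.
Proof. by apply: functional_extensionality => i; rewrite /xor addKb. Qed.

(** Once the preperiod is read, what remains to be added is a tail of [y] that depends only on
    [size u - n] modulo [p]. *)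
Lemma finite_state_xor y p n : 0 < p -> (forall i, n <= i -> y (i + p) = y i) ->
  finite_state (xor y).
Proof.
move=> p0 hy; exists 0 => [m x x' a i|]; first by rewrite subn0 /xor => /a ->.
have per k i : n <= i -> y (i + k * p) = y i.
  elim: k => [|k IH] h; first by rewrite addn0.
  by rewrite mulSn [p + _]addnC addnA hy ?IH // (leq_trans h) ?leq_addr.
apply: (@eventually_finite_valued _ _
  (fun u => xor (shift (n + (size u - n) %% p) y)) n) => [u hu|].
  apply: functional_extensionality => z; apply: functional_extensionality => i.
  rewrite /local_action subn0 /xor /shift prepend_ge; congr (_ (+) _).
  rewrite -[RHS](per ((size u - n) %/ p)); last by rewrite -addnA leq_addr.
  congr (y _); have := divn_eq (size u - n) p; lia.
apply: (finite_valued_map (fun k => xor (shift (n + k) y))).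
by apply: (@finite_valued_nat _ p) => u; rewrite ltnW // ltn_pmod.
Qed.

(* [spread f (1^k 0 z) = 1^k 0 (f z)] for every [k], and [1^omega] is fixed. *)
Fixpoint spread_digit (f : Cantor -> Cantor) (n : nat) (x : Cantor) : bool :=
  match n with
  | 0 => x 0
  | n'.+1 => if x 0 then spread_digit f n' (shift 1 x) else f (shift 1 x) n'
  end.

Definition spread (f : Cantor -> Cantor) (x : Cantor) : Cantor :=
  fun n => spread_digit f n x.

Lemma spread_cons f b z :
  spread f (prepend [:: b] z) = prepend [:: b] (if b then spread f z else f z).
Proof.
apply: functional_extensionality => -[|i] //.
rewrite /spread /= (shift_size_prepend [:: b]) /prepend /= subn1 /=.
by case: b.
Qed.

Lemma spread_prepend f u z : let k := (find negb u).+1 in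
  spread f (prepend u z) =
    if has negb u then prepend (take k u) (f (prepend (drop k u) z))
    else prepend u (spread f z).
Proof.
move=> k; rewrite {}/k; elim: u => [|b u IH]; first by rewrite !prepend_nil.
rewrite -cat1s prepend_cat spread_cons.
case: b => /=; last by rewrite take0 drop0.
by rewrite IH; case: ifP => _; rewrite -prepend_cat.
Qed.

Lemma spread_comp f g x : spread f (spread g x) = spread (fun z => f (g z)) x.
Proof.
apply: functional_extensionality => n; elim: n x => [|n IH] x //.
rewrite -(prepend_head x) !spread_cons; case: (x 0) => //.
by rewrite /prepend /= subn1 /= IH.
Qed.

Lemma spread_id x : spread (fun z => z) x = x.
Proof.
apply: functional_extensionality => n; elim: n x => [|n IH] x //.
rewrite -(prepend_head x) spread_cons; case: (x 0) => //.
by rewrite /prepend /= subn1 /= IH.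
Qed.

(** Before the first 0 the local action is [spread f], after it that of [f] at the letters following
    the 0; in both cases it stands behind a pending word [w u] of at most [c] letters. *)
Lemma finite_state_spread f : finite_state f -> finite_state (spread f).
Proof.
move=> [c d hf]; exists c.
  elim=> [|n IH] x y a; first by rewrite sub0n.
  have h0 : x 0 = y 0 by apply: a.
  have h1 : agree n (shift 1 x) (shift 1 y) by move=> i hi; apply: a.
  rewrite -(prepend_head x) -(prepend_head y) !spread_cons -h0.
  move=> [|i] hi //; rewrite /prepend /= subn1 /=.
  by case: (x 0); [apply: (IH _ _ h1) | apply: (d _ _ _ h1)]; lia.
pose k u := (find negb u).+1.
pose w u := drop (size u - c) (if has negb u then take (k u) u else u).
apply: (@eq_finite_valued _ _ (fun u z => prepend (w u)
  ((if has negb u then local_action c f (drop (k u) u) else spread f) z))).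
  move=> u; apply: functional_extensionality => z.
  rewrite {1}/local_action spread_prepend -/(k u) /w.
  case: ifP => h; rewrite shift_prepend; last first.
    by have -> : size u - c - size u = 0 by lia; rewrite shift0.
  rewrite /local_action size_drop size_take_min.
  move: h; rewrite has_find /k => h.
  set i := minn _ _; set j := size u - (find negb u).+1 - c.
  by have -> : size u - c - i = j by rewrite /i /j; lia.
apply: (finite_valued_map2 (fun w (k : Cantor -> Cantor) z => prepend w (k z)) (P := w)
  (Q := fun u => if has negb u then local_action c f (drop (k u) u) else spread f)).
  apply: (@finite_valued_word _ c) => u; rewrite size_drop.
  by case: ifP => _; rewrite ?size_take_min; lia.
apply: finite_valued_if; first exact: finite_valued_precomp.
by exists unit, (fun _ => tt).
Qed.

(** The local action of [g] at [u] followed by that of [f] at [p u] only prepends the last [c + c]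
    letters of [u]. Local actions of [f] are injective, so the one of [g] is determined by that of
    [f] and by this bounded word. *)
Lemma finite_state_inv c f g : is_inverse f g -> delay c f -> delay c g ->
  finite_valued (local_action c f) -> finite_state g.
Proof.
move=> fg df dg hf; exists c => //.
pose p u := mkseq (g (prepend u zeros)) (size u - c).
pose w (u : seq bool) := drop (size u - c - c) u.
have key u z : local_action c f (p u) (local_action c g u z) = prepend (w u) z.
  rewrite {1}/local_action -(delay_prepend u z zeros dg) (fg _).2 size_mkseq shift_prepend.
  by have -> : size u - c - c - size u = 0 by lia; rewrite shift0.
have inj u : injective (local_action c f u).
  move=> z z' e; apply: (@prepend_inj u).
  rewrite -[LHS](fg _).1 -[RHS](fg _).1 (delay_prepend u z zeros df).
  by rewrite (delay_prepend u z' zeros df) e.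
have hw : finite_valued w.
  by apply: (@finite_valued_word _ (c + c)) => u; rewrite size_drop; lia.
have [S [q hq]] := hf; have [S' [q' hq']] := hw.
exists (S * S')%type, (fun u => (q (p u), q' u)) => u v [/hq e /hq' e'].
apply: functional_extensionality => z; apply: (@inj (p u)).
by rewrite key e key e'.
Qed.

(** * Rational bilipschitz homeomorphisms are finite-state in both directions *)

Definition finite_state_homeo (f : Cantor -> Cantor) : Prop :=
  exists2 g, is_inverse f g & finite_state f /\ finite_state g.

Lemma is_inverse_sym f g : is_inverse f g -> is_inverse g f.
Proof. by move=> h x; have [] := h x. Qed.

Lemma is_inverse_unique f g g' : is_inverse f g -> is_inverse f g' -> g = g'.
Proof.
move=> h h'; apply: functional_extensionality => x.
by rewrite -{1}((h' x).2) (h _).1.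
Qed.

Lemma neq_lcp x y i : x i <> y i -> exists2 n, is_lcp x y n & n <= i.
Proof.
move=> /eqP h; have ex : exists j, x j != y j by exists i.
case: (ex_minnP ex) => n /eqP hn min; exists n; last exact: min.
split=> // j hj; apply/eqP; apply: contraLR hj => /min.
by rewrite -leqNgt.
Qed.

Lemma is_lcp_le x y m n : agree m x y -> is_lcp x y n -> m <= n.
Proof. by move=> a [_ h]; rewrite leqNgt; apply/negP => /a. Qed.

Lemma exists_pow2_ge (C : R) : exists c : nat, (C <= 2 ^ c)%R.
Proof.
have h2 : (Rabs 2 > 1)%R by rewrite Rabs_pos_eq; lra.
have [c hc] := Pow_x_infinity 2 h2 C.
exists c; have := hc c (le_n c); rewrite Rabs_pos_eq; first by lra.
by apply: pow_le; lra.
Qed.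

(** A Lipschitz constant [2 ^ c] means that at most [c] digits of a common prefix are lost. *)
Lemma lipschitz_delay f : lipschitz f <-> exists c, delay c f.
Proof.
split=> [[C hC]|[c d]].
  have [c hc] := exists_pow2_ge C; exists c => m x y a i hi.
  apply: NNPP => /neq_lcp [n hn ni].
  have [k hk] : exists k, is_lcp x y k.
    have [j hj] : exists j, x j <> y j.
      apply: not_all_ex_not => e; case: hn => _; apply.
      by rewrite (functional_extensionality _ _ e).
    by have [k] := neq_lcp hj; exists k.
  have mk := is_lcp_le a hk.
  have := hC x y _ _ (or_intror (ex_intro _ k (conj hk erefl)))
    (or_intror (ex_intro _ n (conj hn erefl))).
  (* The images part at [n < m - c] while the points agree up to [k >= m], so the last exponent is
     positive and the Lipschitz bound fails strictly. *)
  have -> : k = n + c + (k - n - c) by lia.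
  rewrite !pow_add => le1.
  have h1 : (0 < (/ 2) ^ n)%R by apply: pow_lt; lra.
  have h2 : ((/ 2) ^ (k - n - c) < 1)%R by apply: (proj2 (pow_lt_1_compat _ _ _ _)); [lra | lia].
  have h2' : (0 < (/ 2) ^ (k - n - c))%R by apply: pow_lt; lra.
  have h3 : (0 < (/ 2) ^ c)%R by apply: pow_lt; lra.
  have h4 : (C * (/ 2) ^ c <= 1)%R.
    apply: (Rle_trans _ (2 ^ c * (/ 2) ^ c)%R); first exact: Rmult_le_compat_r (Rlt_le _ _ h3) hc.
    by rewrite -Rpow_mult_distr Rinv_r ?pow1; lra.
  have h5 := Rmult_lt_0_compat _ _ h1 h2'.
  have h6 := Rmult_le_compat_r _ _ _ (Rlt_le _ _ h5) h4.
  have h7 := Rmult_lt_compat_l _ _ _ h1 h2.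
  lra.
exists (2 ^ c)%R => x y r s hxy hfxy.
have c0 : (0 < 2 ^ c)%R by apply: pow_lt; lra.
have r0 : (0 <= r)%R by case: hxy => [[_ ->]|[n [_ ->]]]; [lra | apply: pow_le; lra].
case: hfxy => [[_ ->]|[k [hk ->]]]; first by nra.
case: hxy => [[e _]|[n [hn ->]]]; first by case: hk => _; rewrite e.
have le := is_lcp_le (d _ _ _ hn.1) hk.
apply: (Rmult_le_reg_l ((/ 2) ^ c)%R); first by apply: pow_lt; lra.
rewrite -Rmult_assoc -Rpow_mult_distr Rinv_l ?pow1 ?Rmult_1_l; last lra.
rewrite -pow_add; have -> : (Nat.add c k) = n + (c + k - n) by lia.
rewrite pow_add; have h1 : (0 < (/ 2) ^ n)%R by apply: pow_lt; lra.
have h2 : ((/ 2) ^ (c + k - n) <= 1)%R.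
  by rewrite -(pow1 (c + k - n)); apply: pow_incr; lra.
nra.
Qed.

Lemma delay_continuous c f : delay c f -> ccontinuous f.
Proof. by move=> d x n; exists (n + c) => y /d; rewrite addnK. Qed.

(** A state is a class of input words with the same label and the same length truncated at [c]; the
    truncated length tells whether output has begun. *)
Lemma finite_state_transducer f : finite_state f ->
  exists T : transducer, forall x, transducer_output (tinit T) x (f x).
Proof.
move=> [c d [S [q hq]]].
pose q' u : 'I_c.+1 * S := (inord (minn (size u) c), q u).
have q'P u v : q' u = q' v ->
    minn (size u) c = minn (size v) c /\ local_action c f u = local_action c f v.
  move=> [/(congr1 val) /= h1 /hq h2]; split=> //.
  by rewrite -[LHS](@inordK c) ?ltnS ?geq_minr // h1 inordK // ltnS geq_minr.
(* Transitions and outputs are computed on a chosen representative of each class. *)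
have [rep repP] : exists rep : 'I_c.+1 * S -> seq bool, forall u, q' (rep (q' u)) = q' u.
  have /fin_all_exists [r hr] : forall s, exists u, (exists v, q' v = s) -> q' u = s.
    move=> s; case: (classic (exists v, q' v = s)) => [[v hv]|h]; first by exists v.
    by exists [::].
  by exists r => u; apply: hr; exists u.
(* One more digit is dropped exactly when [c <= size u]; the boolean is coerced to 0 or 1. *)
have la_rcons u b z : local_action c f (rcons u b) z =
    shift (size u < c == false) (local_action c f u (prepend [:: b] z)).
  rewrite /local_action shiftD -cats1 prepend_cat size_cat /=.
  by have -> : size u + 1 - c = (size u < c == false) + (size u - c) by case: ltnP => /=; lia.
(* The first [c] letters write nothing, each later one writes one digit. By the delay bound this
   digit does not depend on the continuation, here [zeros]. *)
exists (@Transducer ('I_c.+1 * S)%type (q' [::]) (fun s b => q' (rcons (rep s) b))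
  (fun s b => if size (rep s) < c then [::]
              else [:: local_action c f (rep s) (prepend [:: b] zeros) 0])) => x.
set T := Transducer _ _ _.
have st n : let r := rep (tstate_after (tinit T) x n) in
    minn (size r) c = minn n c /\ local_action c f r = local_action c f (mkseq x n).
  elim: n => [|n [IH1 IH2]] /=; first exact: (q'P _ [::] (repP _)).
  set r := rep _ in IH1 IH2 *.
  have [-> ->] := q'P _ _ (repP (rcons r (x n))); split; first by rewrite size_rcons; lia.
  apply: functional_extensionality => z.
  rewrite mkseqS !la_rcons IH2 size_mkseq.
  by have -> : (size r < c) = (n < c) by lia.
have outE n : tout_prefix (tinit T) x n = mkseq (f x) (n - c).
  elim: n => [|n IH] //=; rewrite IH.
  have [h1 h2] := st n; set r := rep _ in h1 h2 *.
  have -> : (size r < c) = (n < c) by lia.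
  case: ltnP => h.
    by have [-> ->] : n - c = 0 /\ n.+1 - c = 0 by lia.
  rewrite subSn // mkseqS -cats1 h2 /local_action /shift size_mkseq addn0.
  congr (_ ++ [:: _]); rewrite -prepend_cat cats1 -mkseqS.
  apply: (d n.+1); last by lia.
  rewrite -{2}(prepend_mkseq n.+1 x).
  by have := @agree_prepend (mkseq x n.+1) zeros (shift n.+1 x); rewrite size_mkseq.
split=> [k|n i]; rewrite ?outE.
  by exists (k.+1 + c); rewrite outE size_mkseq addnK.
by rewrite size_mkseq => h; rewrite nth_mkseq.
Qed.

Section TransducerWords.
Variable T : transducer.
Implicit Types (s : tstate T) (x y z : Cantor).

Lemma tstate_after_agree s x y n : agree n x y -> tstate_after s x n = tstate_after s y n.
Proof.
elim: n => [|n IH] //= a; rewrite IH; last exact: agreeW a.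
by rewrite a.
Qed.

Lemma tout_prefix_agree s x y n : agree n x y -> tout_prefix s x n = tout_prefix s y n.
Proof.
elim: n => [|n IH] //= a; have a' := agreeW (leqnSn n) a.
by rewrite IH // a // (tstate_after_agree s a').
Qed.

Lemma tstate_after_add s x n k :
  tstate_after s x (n + k) = tstate_after (tstate_after s x n) (shift n x) k.
Proof. by elim: k => [|k IH]; rewrite ?addn0 // addnS /= IH. Qed.

Lemma tout_prefix_add s x n k : tout_prefix s x (n + k) =
  tout_prefix s x n ++ tout_prefix (tstate_after s x n) (shift n x) k.
Proof.
by elim: k => [|k IH]; rewrite ?addn0 ?cats0 // addnS /= IH tstate_after_add catA.
Qed.

Lemma transducer_output_unique s x y y' :
  transducer_output s x y -> transducer_output s x y' -> y = y'.
Proof.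
move=> [h1 h2] [_ h2']; apply: functional_extensionality => i.
by have [n hn] := h1 i; rewrite -(h2 n) // h2'.
Qed.

Lemma transducer_output_shift s x y n : transducer_output s x y ->
  prepend (tout_prefix s x n) (shift (size (tout_prefix s x n)) y) = y /\
  transducer_output (tstate_after s x n) (shift n x) (shift (size (tout_prefix s x n)) y).
Proof.
move=> [h1 h2]; set w := tout_prefix s x n; split.
  apply: functional_extensionality => i; rewrite /prepend.
  by case: ltnP => h; [apply: h2 | rewrite /shift subnKC].
split=> [k|m i hi].
  have [m hm] := h1 (size w + k); exists m.
  suff : size (tout_prefix s x m) <= size (tout_prefix s x (n + m)).
    by rewrite tout_prefix_add size_cat -/w; lia.
  by rewrite addnC tout_prefix_add size_cat leq_addr.
have := h2 (n + m) (size w + i).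
rewrite tout_prefix_add -/w size_cat ltn_add2l => /(_ hi) e.
by rewrite -[RHS]e nth_cat ltnNge leq_addr /= addKn.
Qed.

End TransducerWords.

(** After [u] the transducer has written [out u], and the rest depends only on its state. For
    finitely many local actions, [size (out u)] must stay within bounded distance of [size u - c]:
    the delay of [g] bounds the surplus, finiteness of the state set the lag [e u]. *)
Lemma transducer_finite_state c f g (T : transducer) :
  is_inverse f g -> delay c f -> delay c g ->
  (forall x, transducer_output (tinit T) x (f x)) -> finite_valued (local_action c f).
Proof.
move=> fg df dg hT.
pose st u := tstate_after (tinit T) (prepend u zeros) (size u).
pose out u := tout_prefix (tinit T) (prepend u zeros) (size u).
pose rest u z := shift (size (out u)) (f (prepend u z)).
have outP u z : f (prepend u z) = prepend (out u) (rest u z) /\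
    transducer_output (st u) z (rest u z).
  have [] := transducer_output_shift (size u) (hT (prepend u z)).
  have a := @agree_prepend u z zeros.
  rewrite (tstate_after_agree (tinit T) a) (tout_prefix_agree (tinit T) a) shift_size_prepend.
  by split.
have restP u v : st u = st v -> rest u = rest v.
  move=> e; apply: functional_extensionality => z.
  have := (outP v z).2; rewrite -e => h; exact: transducer_output_unique (outP u z).2 h.
(* If all images of the cone [u] share [n] digits, [g] recovers [n - c] common digits of the cone
   itself, but two of its points already differ at position [size u]. *)
have common_bound u n : (forall z z', agree n (f (prepend u z)) (f (prepend u z'))) ->
    n <= size u + c.
  move=> /(_ zeros (fun _ => true)) /dg; rewrite !(fg _).1 => a.
  rewrite leqNgt; apply/negP => h.
  have := a (size u); rewrite -(addn0 (size u)) !prepend_ge /= => a'.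
  by suff : false = true by []; apply: a'; lia.
have out_bound u : size (out u) <= size u + c.
  apply: common_bound => z z'; rewrite (outP u z).1 (outP u z').1.
  exact: agree_prepend.
pose e u := size u - c - size (out u).
(* Fix a word [v] for each reached state. Any [u] reaching it has the same [rest], whose first [e u]
   digits do not depend on the input; behind [out v] they are common to all images of the cone [v],
   and [common_bound] applies. *)
have [K hK] : exists K, forall u, e u <= K.
  have /fin_all_exists [B hB] : forall s, exists B, forall u, st u = s -> e u <= B.
    move=> s; case: (classic (exists v, st v = s)) => [[v hv]|h]; last first.
      by exists 0 => u hu; case: h; exists u.
    exists (size v + c) => u hu.
    suff : size (out v) + e u <= size v + c by lia.
    apply: common_bound => z z' i hi.
    rewrite (outP v z).1 (outP v z').1 -(restP u v) ?hu // /prepend.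
    case: ltnP => // h.
    have := df (size u) _ _ (@agree_prepend u z z') (size (out u) + (i - size (out v))).
    rewrite (outP u z).1 (outP u z').1 !prepend_ge; apply.
    by move: hi; rewrite /e; lia.
  by exists (\max_s B s) => u; apply: leq_trans (hB _ u erefl) (leq_bigmax _).
(* Subtraction is truncated, so at most one of the word and the shift is nontrivial. *)
apply: (@eq_finite_valued _ _ (fun u z => prepend (drop (size u - c) (out u)) (shift (e u) (rest u z)))).
  by move=> u; apply: functional_extensionality => z; rewrite /local_action (outP u z).1 shift_prepend.
apply: (finite_valued_map2 (fun w (k : Cantor -> Cantor) z => prepend w (k z))
  (P := fun u => drop (size u - c) (out u)) (Q := fun u z => shift (e u) (rest u z))).
  by apply: (@finite_valued_word _ (c + c)) => u; rewrite size_drop; have := out_bound u; lia.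
apply: (finite_valued_map2 (fun n (k : Cantor -> Cantor) z => shift n (k z)) (P := e) (Q := rest)).
  exact: finite_valued_nat hK.
by exists (tstate T), st.
Qed.

Lemma RBLP f : RBL f <-> finite_state_homeo f.
Proof.
split=> [[[_ [T hT]] [/lipschitz_delay [c dc] [g [fg /lipschitz_delay [c' dc']]]]] | [g fg [hf hg]]].
  exists g => //.
  have d := delayW (leq_addr c' c) dc; have d' := delayW (leq_addl c c') dc'.
  have fin := transducer_finite_state fg d d' hT.
  by split; [exists (c + c') | apply: finite_state_inv fg d d' fin].
have [T hT] := finite_state_transducer hf.
have [c d _] := hf; have [c' d' _] := hg.
split; [split; [split|by exists T] | split].
- exact: delay_continuous d.
- by exists g; split=> //; apply: delay_continuous d'.
- by apply/lipschitz_delay; exists c.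
- by exists g; split=> //; apply/lipschitz_delay; exists c'.
Qed.

Lemma RBL_intro f g : is_inverse f g -> finite_state f -> finite_state g -> RBL f.
Proof. by move=> fg hf hg; apply/RBLP; exists g. Qed.

Lemma RBL_finite_state f : RBL f -> finite_state f.
Proof. by move/RBLP => [g _ []]. Qed.

Lemma RBL_inverse f : RBL f -> exists2 g, is_inverse f g & RBL g.
Proof.
move/RBLP => [g fg [hf hg]]; exists g => //.
by apply: (@RBL_intro g f) => //; apply: is_inverse_sym.
Qed.

Lemma RBL_id : RBL (fun x => x).
Proof. by apply: (@RBL_intro _ (fun x => x)) => //; apply: finite_state_id. Qed.

Lemma is_inverse_comp f f' g g' : is_inverse f f' -> is_inverse g g' ->
  is_inverse (fun x => f (g x)) (fun x => g' (f' x)).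
Proof. by move=> h h' x; rewrite (h _).1 (h' _).1 (h' _).2 (h _).2. Qed.

Lemma RBL_comp f g : RBL f -> RBL g -> RBL (fun x => f (g x)).
Proof.
move=> /RBLP [f' ff' [hf hf']] /RBLP [g' gg' [hg hg']].
by apply: (RBL_intro (is_inverse_comp ff' gg')); apply: finite_state_comp.
Qed.

Lemma RBL_inv f g : RBL f -> is_inverse f g -> RBL g.
Proof. by move=> /RBL_inverse [g' h hg] /(is_inverse_unique h) <-. Qed.

Lemma RBL_subgroup : is_subgroup RBL.
Proof.
split; first by move=> f [[]].
split; first exact: RBL_id.
by split; [apply: RBL_comp | apply: RBL_inv].
Qed.

Lemma RBL_xor y p n : 0 < p -> (forall i, n <= i -> y (i + p) = y i) -> RBL (xor y).
Proof.
move=> p0 hy; have h := finite_state_xor p0 hy.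
by apply: (@RBL_intro _ (xor y)) => // x; rewrite !xorK.
Qed.

Lemma is_inverse_spread f g : is_inverse f g -> is_inverse (spread f) (spread g).
Proof.
move=> fg x; rewrite !spread_comp; split; rewrite -[RHS]spread_id;
  congr (spread _ _); apply: functional_extensionality => z.
- exact: (fg z).1.
- exact: (fg z).2.
Qed.

Lemma RBL_spread f : RBL f -> RBL (spread f).
Proof.
move=> /RBLP [g fg [hf hg]].
by apply: (RBL_intro (is_inverse_spread fg)); apply: finite_state_spread.
Qed.

(** * Cone extensions and transitivity on proper cones *)

Definition cone_ext (u : seq bool) (f : Cantor -> Cantor) (x : Cantor) : Cantor :=
  if in_cone u x then prepend u (f (shift (size u) x)) else x.

Lemma cone_ext_prepend u f z : cone_ext u f (prepend u z) = prepend u (f z).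
Proof. by rewrite /cone_ext in_cone_prepend shift_size_prepend. Qed.

Lemma cone_ext_out u f x : ~~ in_cone u x -> cone_ext u f x = x.
Proof. by rewrite /cone_ext => /negbTE ->. Qed.

Lemma cone_ext_comp u f g x : cone_ext u f (cone_ext u g x) = cone_ext u (fun z => f (g z)) x.
Proof.
case: (boolP (in_cone u x)) => [/in_coneE <- | h]; first by rewrite !cone_ext_prepend.
by rewrite !cone_ext_out.
Qed.

Lemma cone_ext_id u x : cone_ext u (fun z => z) x = x.
Proof. by rewrite /cone_ext; case: ifP => // /in_coneE. Qed.

Lemma is_inverse_cone_ext u f g : is_inverse f g -> is_inverse (cone_ext u f) (cone_ext u g).
Proof.
move=> fg x; rewrite !cone_ext_comp; split; rewrite -[RHS](cone_ext_id u);
  congr (cone_ext _ _ _); apply: functional_extensionality => z.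
- exact: (fg z).1.
- exact: (fg z).2.
Qed.

Lemma finite_state_cone_ext u f : finite_state f -> finite_state (cone_ext u f).
Proof.
move=> hf; apply: (@finite_state_if (in_cone u) (size u)
  (fun x => prepend u (f (shift (size u) x))) (fun x => x)).
- exact: in_cone_agree.
- apply: (finite_state_comp (f := prepend u)); first exact: finite_state_prepend.
  by apply: finite_state_comp => //; apply: finite_state_shift.
- exact: finite_state_id.
Qed.

Lemma RBL_cone_ext u f : RBL f -> RBL (cone_ext u f).
Proof.
move=> /RBLP [g fg [hf hg]].
by apply: (RBL_intro (is_inverse_cone_ext u fg)); apply: finite_state_cone_ext.
Qed.

(** Knowing [k] on the cone [u] is enough, because off the cones the extensions are trivial. *)
Lemma cone_ext_conj k ki u v f : is_inverse k ki ->
  (forall z, k (prepend u z) = prepend v z) ->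
  (fun x => k (cone_ext u f (ki x))) = cone_ext v f.
Proof.
move=> kk h; apply: functional_extensionality => x.
case: (boolP (in_cone v x)) => [/in_coneE <- | hx].
  by rewrite -h (kk _).1 cone_ext_prepend !h cone_ext_prepend.
rewrite (cone_ext_out _ hx) cone_ext_out ?(kk _).2 //.
apply: contra hx => /in_coneE e.
by rewrite -(kk x).2 -e h in_cone_prepend.
Qed.

(** An element of Thompson's group [F]: it sends 1z to 11z, 01z to 10z and 00z to 0z. *)
Definition stretch (x : Cantor) : Cantor :=
  if in_cone [:: true] x then prepend [:: true] x
  else if in_cone [:: false; true] x then prepend [:: true; false] (shift 2 x)
  else shift 1 x.

Definition stretch_inv (x : Cantor) : Cantor :=
  if in_cone [:: false] x then prepend [:: false] x
  else if in_cone [:: true; false] x then prepend [:: false; true] (shift 2 x)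
  else shift 1 x.

Lemma stretch1 z : stretch (prepend [:: true] z) = prepend [:: true; true] z.
Proof. by rewrite /stretch in_cone_prepend -prepend_cat. Qed.

Lemma is_inverse_stretch : is_inverse stretch stretch_inv.
Proof.
have E x : x = prepend [:: x 0; x 1] (shift 2 x) by rewrite (prepend_mkseq 2).
have c1 a b w z : in_cone [:: a] (prepend (b :: w) z) = (b == a) by case: a; case: b.
have c2 a a' b b' w z : in_cone [:: a; a'] (prepend (b :: b' :: w) z) = (b == a) && (b' == a').
  by case: a; case: b; case: a'; case: b'.
have s1 a w z : shift 1 (prepend (a :: w) z) = prepend w z.
  by rewrite shift_prepend /= drop0 shift0.
have s2 a b w z : shift 2 (prepend (a :: b :: w) z) = prepend w z.
  by rewrite shift_prepend /= drop0 shift0.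
move=> x; rewrite (E x); move: (x 0) (x 1) (shift 2 x) => a b z.
rewrite /stretch /stretch_inv.
by case: a; case: b; split;
  do 3 rewrite ?(c1, c2, s1, s2) -?prepend_cat /=.
Qed.

Lemma RBL_stretch : RBL stretch.
Proof.
apply: (RBL_intro is_inverse_stretch).
- apply: (finite_state_if (@in_cone_agree [:: true])); first exact: finite_state_prepend.
  apply: (finite_state_if (@in_cone_agree [:: false; true])); last exact: finite_state_shift.
  by apply: finite_state_comp; [apply: finite_state_prepend | apply: finite_state_shift].
- apply: (finite_state_if (@in_cone_agree [:: false])); first exact: finite_state_prepend.
  apply: (finite_state_if (@in_cone_agree [:: true; false])); last exact: finite_state_shift.
  by apply: finite_state_comp; [apply: finite_state_prepend | apply: finite_state_shift].
Qed.

Definition moves_cone (u v : seq bool) : Prop :=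
  exists2 k, RBL k & forall z, k (prepend u z) = prepend v z.

Lemma moves_cone_sym u v : moves_cone u v -> moves_cone v u.
Proof.
move=> [k /RBL_inverse [ki kk hki] h]; exists ki => // z.
by rewrite -h (kk _).1.
Qed.

Lemma moves_cone_trans u v w : moves_cone u v -> moves_cone v w -> moves_cone u w.
Proof.
move=> [k hk h] [l hl h']; exists (fun x => l (k x)); first exact: RBL_comp.
by move=> z; rewrite h h'.
Qed.

(** Adding modulo 2 the digitwise sum of [u] and [v], padded with zeros, exchanges the two cones. *)
Lemma moves_cone_size u v : size u = size v -> moves_cone u v.
Proof.
move=> e; pose y : Cantor := fun i => nth false u i (+) nth false v i.
have y0 i : size u <= i -> y i = false by move=> h; rewrite /y !nth_default // -e.
exists (xor y).
  by apply: (@RBL_xor y 1 (size u)) => // i h; rewrite !y0 // (leq_trans h) ?leq_addr.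
move=> z; apply: functional_extensionality => i; rewrite /xor /prepend -e.
by case: ltnP => h; [rewrite /y addbAC addbb | rewrite y0].
Qed.

(** Each word is moved to the string of ones of its length, and [stretch] relates strings of ones of
    consecutive lengths. *)
Lemma cone_transitive u v : 0 < size u -> 0 < size v -> moves_cone u v.
Proof.
have ones n : moves_cone (nseq n.+1 true) [:: true].
  elim: n => [|n IH]; first exact: moves_cone_size.
  apply: moves_cone_trans IH; apply: moves_cone_sym.
  exists stretch; first exact: RBL_stretch.
  move=> z; rewrite -[nseq n.+1 true]/([:: true] ++ nseq n true) prepend_cat stretch1.
  by rewrite -prepend_cat.
have one w : 0 < size w -> moves_cone w [:: true].
  case: w => // b w _; apply: moves_cone_trans (ones (size w)).
  by apply: moves_cone_size; rewrite size_nseq.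
by move=> /one hu /one /moves_cone_sym; apply: moves_cone_trans.
Qed.

(** * Simplicity *)

(* Swindle: [spread f] performs [f] on each cone [1^k 0], and conjugating by
   [stretch] removes the first copy. *)
Lemma cone_ext_commutator f g : is_inverse f g ->
  cone_ext [:: true; false] f =
  (fun x => cone_ext [:: true] (spread f)
     (stretch (cone_ext [:: true] (spread g) (stretch_inv x)))).
Proof.
move=> fg; apply: functional_extensionality => x.
(* The conjugate acts by [spread g] on the cone 11, which cancels every copy of [f] except the one
   on the cone 10. *)
have e := @cone_ext_conj _ _ [:: true] [:: true; true] (spread g) is_inverse_stretch stretch1.
have {e} -> := congr1 (fun k => k x) e.
have -> : x = prepend [:: x 0; x 1] (shift 2 x) by rewrite (prepend_mkseq 2).
move: (x 0) (x 1) (shift 2 x) => [] [] z.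
- rewrite cone_ext_out // cone_ext_prepend -[[:: true; true]]/([:: true] ++ [:: true]).
  have fgid : (fun z => f (g z)) = fun z => z.
    by apply: functional_extensionality => t; rewrite (fg t).2.
  by rewrite !prepend_cat cone_ext_prepend spread_cons spread_comp fgid spread_id.
- rewrite cone_ext_prepend (cone_ext_out (u := [:: true; true])) //.
  rewrite -[[:: true; false]]/([:: true] ++ [:: false]) !prepend_cat.
  by rewrite cone_ext_prepend spread_cons.
- by rewrite !cone_ext_out.
- by rewrite !cone_ext_out.
Qed.

(** As [f] is injective and fixes the cone 0 pointwise, no point of the cone 1 can land in the cone
    0. The same holds for the inverse, so both restrict to the cone 1. *)
Lemma RBL_cone_extP f : RBL f -> (forall z, f (prepend [:: false] z) = prepend [:: false] z) ->
  exists2 g, RBL g & f = cone_ext [:: true] g.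
Proof.
move=> /RBLP [fi ff [hf hfi]] fix0.
have fixi0 z : fi (prepend [:: false] z) = prepend [:: false] z.
  by rewrite -{1}fix0 (ff _).1.
have stable k ki z : is_inverse k ki -> (forall z, k (prepend [:: false] z) = prepend [:: false] z) ->
    prepend [:: true] (shift 1 (k (prepend [:: true] z))) = k (prepend [:: true] z).
  move=> kk fixk; rewrite -{2}(prepend_head (k _)); case h : (k _ 0) => //.
  have := prepend_head (k (prepend [:: true] z)); rewrite h -fixk => /(congr1 ki).
  by rewrite !(kk _).1 => /(congr1 (fun x : Cantor => x 0)).
have fs k : finite_state k -> finite_state (fun z => shift 1 (k (prepend [:: true] z))).
  move=> hk; apply: (finite_state_comp (f := shift 1)); first exact: finite_state_shift.
  by apply: finite_state_comp => //; apply: finite_state_prepend.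
exists (fun z => shift 1 (f (prepend [:: true] z))).
  apply: (@RBL_intro _ (fun z => shift 1 (fi (prepend [:: true] z)))); try exact: fs.
  move=> z; rewrite (stable f fi) // (stable fi f) //; last exact: is_inverse_sym.
  by rewrite (ff _).1 (ff _).2 (shift_size_prepend [:: true]).
apply: functional_extensionality => x; rewrite -(prepend_head x); case: (x 0).
  by rewrite cone_ext_prepend (stable f fi).
by rewrite fix0 cone_ext_out.
Qed.

Lemma displaced_cone f x : RBL f -> f x <> x ->
  exists2 w, 0 < size w & forall y, in_cone w y -> ~~ in_cone w (f y).
Proof.
move=> /RBL_finite_state [c d _] ne.
have [i hi] : exists i, f x i <> x i.
  by apply: not_all_ex_not => e; apply: ne; apply: functional_extensionality.
(* The [c] extra digits make digit [i] of the image constant on the cone. *)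
exists (mkseq x (i.+1 + c)); first by rewrite size_mkseq.
have E y : in_cone (mkseq x (i.+1 + c)) y -> agree (i.+1 + c) x y.
  by rewrite /in_cone size_mkseq agree_mkseq => /eqP ->.
move=> y /E /d; rewrite addnK => a; apply/negP => /E b.
by apply: hi; rewrite a // b //; lia.
Qed.

Section NormalSubgroup.
Variable N : (Cantor -> Cantor) -> Prop.
Hypothesis normN : is_normal_subgroup_of N RBL.

Lemma normal_cone_ext u v f : 0 < size u -> 0 < size v ->
  N (cone_ext u f) -> N (cone_ext v f).
Proof.
move=> hu hv hN; have [k hk h] := cone_transitive hu hv.
have [ki kk _] := RBL_inverse hk.
by rewrite -(cone_ext_conj f kk h); apply: (normN.2.2).
Qed.

(** Conjugation moving the cone [w] to the cone 0 turns [g] into a map supported on the cone 1. *)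
Lemma normal_cone_fixing g w : (forall f, RBL f -> N (cone_ext [:: true] f)) ->
  RBL g -> 0 < size w -> (forall z, g (prepend w z) = prepend w z) -> N g.
Proof.
move=> hN hg hw fixw; have [k hk h] := @cone_transitive w [:: false] hw isT.
have [ki kk hki] := RBL_inverse hk.
have [f hf e] : exists2 f, RBL f & (fun x => k (g (ki x))) = cone_ext [:: true] f.
  apply: RBL_cone_extP => [|z]; last by rewrite -h (kk _).1 fixw.
  by apply: (RBL_comp hk); apply: RBL_comp.
have := normN.2.2 _ _ _ (hN _ hf) hki (is_inverse_sym kk); rewrite -e.
suff -> : (fun x => ki (k (g (ki (k x))))) = g by [].
by apply: functional_extensionality => x; rewrite !(kk _).1.
Qed.

(* [f] is the product of the involution [s] exchanging a small cone [w0] with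
   [f w0], which fixes [w1], and of [s f], which fixes [w0]. *)
Lemma normal_eq_RBL : (forall f, RBL f -> N (cone_ext [:: true] f)) ->
  forall f, RBL f -> N f.
Proof.
move=> hN f hf; case: (classic (exists x, f x <> x)) => [[x ne]|triv]; last first.
  suff -> : f = fun x => x by apply: normN.1.2.1.
  apply: functional_extensionality => x; apply: NNPP => ne.
  by apply: triv; exists x.
have [w hw disj] := displaced_cone hf ne.
have [g fg hg] := RBL_inverse hf.
(* Only half of [w] is exchanged with its image, which lies off [w]; the other half stays fixed by
   [s]. *)
pose w0 := rcons w false.
have w0w y : in_cone w0 y -> in_cone w y.
  by move/in_coneE <-; rewrite /w0 -cats1 prepend_cat in_cone_prepend.
pose s y := if in_cone w0 y then f y else if in_cone w0 (g y) then g y else y.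
have sf y : in_cone w0 y -> s (f y) = y.
  move=> h; rewrite /s (fg _).1 h.
  by case: ifP => // /w0w; rewrite (negbTE (disj _ (w0w _ h))).
have ss y : s (s y) = y.
  rewrite {2}/s; case: ifP => [|h]; first exact: sf.
  case: ifP => h'; last by rewrite /s h h'.
  by rewrite /s h' (fg _).2.
have fss : finite_state s.
  apply: (finite_state_if (@in_cone_agree w0)); first exact: RBL_finite_state.
  have [c d _] := RBL_finite_state hg.
  apply: (@finite_state_if (fun y => in_cone w0 (g y)) (size w0 + c)).
  - by move=> y y' /d; rewrite addnK; apply: in_cone_agree.
  - exact: RBL_finite_state.
  - exact: finite_state_id.
have hs : RBL s by apply: (@RBL_intro s s).
have -> : f = fun y => s (s (f y)).
  by apply: functional_extensionality => y; rewrite ss.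
apply: (normN.1.2.2.1 s (fun y => s (f y))).
  apply: (@normal_cone_fixing _ (rcons w true)) => //; first by rewrite size_rcons.
  move=> z; have hz : in_cone w (prepend (rcons w true) z).
    by rewrite -cats1 prepend_cat in_cone_prepend.
  rewrite /s; case: ifP => [/in_coneE /(congr1 (fun x : Cantor => x (size w)))|_].
    by rewrite !prepend_lt ?size_rcons // /w0 !nth_rcons ltnn eqxx.
  case: ifP => // /w0w /disj; rewrite (fg _).2.
  by rewrite hz.
apply: (@normal_cone_fixing _ w0) => //; first exact: RBL_comp.
  by rewrite size_rcons.
by move=> z; rewrite sf // in_cone_prepend.
Qed.

(* [f] moves the cone [w] off itself, so [[[a, f], b] = [a, b]] for [a] and [b]
   supported on [w]. *)
Lemma normal_commutator f w a ai b bi : N f ->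
  (forall y, in_cone w y -> ~~ in_cone w (f y)) ->
  RBL a -> RBL b -> is_inverse a ai -> is_inverse b bi ->
  N (cone_ext w (fun x => a (b (ai (bi x))))).
Proof.
move=> hf disj ha hb aa bb.
set A := cone_ext w a; set Ai := cone_ext w ai.
set B := cone_ext w b; set Bi := cone_ext w bi.
have AA : is_inverse A Ai by apply: is_inverse_cone_ext.
have BB : is_inverse B Bi by apply: is_inverse_cone_ext.
have [fi ff _] := RBL_inverse (normN.2.1 _ hf).
have mulN := normN.1.2.2.1; have invN := normN.1.2.2.2.
(* [k] is the commutator of [A] and [f]: a conjugate of [f] times the inverse of [f], hence in
   [N]. *)
pose k x := A (f (Ai (fi x))); pose ki x := f (A (fi (Ai x))).
have kk : is_inverse k ki.
  move=> x; rewrite /k /ki (AA _).1 (ff _).1 (AA _).2 (ff _).2.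
  by rewrite (ff _).1 (AA _).1 (ff _).2 (AA _).2.
have hk : N k.
  apply: (mulN (fun x => A (f (Ai x))) fi); last exact: invN ff.
  by apply: (normN.2.2) => //; apply: RBL_cone_ext.
have hN : N (fun x => k (B (ki (Bi x)))).
  apply: (mulN k (fun x => B (ki (Bi x)))) => //.
  apply: (normN.2.2) => //; last exact: RBL_cone_ext.
  exact: invN kk.
(* The conjugate of [A] by [f] is supported on the image of [w], disjoint from [w], so it commutes
   with [B]. *)
have comm x : f (Ai (fi (B (f (A (fi x)))))) = B x.
  have cone_stable c y : in_cone w (cone_ext w c y) = in_cone w y.
    by case: (boolP (in_cone w y)) => [/in_coneE <-|h];
      rewrite ?cone_ext_prepend ?in_cone_prepend // cone_ext_out // (negbTE h).
  case: (boolP (in_cone w x)) => hx.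
    have out y : in_cone w y -> ~~ in_cone w (fi y).
      by move=> hy; apply/negP => /disj; rewrite (ff _).2 hy.
    rewrite /A cone_ext_out ?out // (ff _).2 /Ai cone_ext_out ?(ff _).2 //.
    by rewrite out // cone_stable.
  suff hx' : ~~ in_cone w (f (A (fi x))).
    rewrite /B (cone_ext_out _ hx') (ff _).1 (AA _).1 (ff _).2.
    by rewrite cone_ext_out.
  case: (boolP (in_cone w (fi x))) => h; first by apply: disj; rewrite cone_stable.
  by rewrite /A cone_ext_out // (ff _).2.
suff -> : cone_ext w (fun x => a (b (ai (bi x)))) = fun x => k (B (ki (Bi x))) by [].
apply: functional_extensionality => x; rewrite /k /ki comm.
by rewrite /A /Ai /B /Bi !cone_ext_comp.
Qed.

(** This lets [normal_eq_RBL] be applied a second time, to the maps acting inside the cone [w]. *)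
Lemma normal_preimage_cone_ext w :
  is_normal_subgroup_of (fun f => RBL f /\ N (cone_ext w f)) RBL.
Proof.
have extE f g : (fun x => cone_ext w f (cone_ext w g x)) = cone_ext w (fun z => f (g z)).
  by apply: functional_extensionality => x; rewrite cone_ext_comp.
split; last split.
- split; first by move=> f [[[]]].
  split.
    split; first exact: RBL_id.
    suff -> : cone_ext w (fun x => x) = fun x => x by apply: normN.1.2.1.
    by apply: functional_extensionality => x; rewrite cone_ext_id.
  split=> f g.
    move=> [hf nf] [hg ng]; split; first exact: RBL_comp.
    by rewrite -extE; apply: normN.1.2.2.1.
  move=> [hf nf] fg; split; first exact: RBL_inv fg.
  exact: (normN.1.2.2.2 _ _ nf (is_inverse_cone_ext w fg)).
- by move=> f [].
- move=> f h hi [hf nf] hh hhi; split.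
    by apply: (RBL_comp hh); apply: RBL_comp => //; apply: RBL_inv hhi.
  have := normN.2.2 _ _ _ nf (RBL_cone_ext w hh) (is_inverse_cone_ext w hhi).
  by rewrite -(extE h (fun z => f (hi z))) -(extE f hi).
Qed.

End NormalSubgroup.

Lemma RBL_simple : simple_group RBL.
Proof.
split.
  exists (xor (fun _ => true)); split; first by apply: (@RBL_xor _ 1 0).
  by exists zeros => /(congr1 (fun x : Cantor => x 0)).
move=> N normN; case: (classic (exists2 f, N f & exists x, f x <> x)) => [|h]; last first.
  by left=> f hf x; apply: NNPP => ne; apply: h; exists f => //; exists x.
move=> [f hf [x ne]]; right.
have [w hw disj] := displaced_cone (normN.2.1 _ hf) ne.
apply: (normal_eq_RBL normN) => a ha.
apply: (normal_cone_ext normN hw) => //.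
(* Inside [w] it suffices to treat maps supported on a single proper subcone; the cone 10 is chosen,
   where the swindle yields a commutator. *)
apply: (proj2 (normal_eq_RBL (normal_preimage_cone_ext normN w) _ ha)) => {ha}a ha.
apply: (@normal_cone_ext _ (normal_preimage_cone_ext normN w) [:: true; false]) => //.
split; first exact: RBL_cone_ext.
have [ai aa _] := RBL_inverse ha.
rewrite (cone_ext_commutator aa); apply: (normal_commutator normN hf).
- exact: disj.
- by apply/RBL_cone_ext/RBL_spread.
- exact: RBL_stretch.
- exact/is_inverse_cone_ext/is_inverse_spread.
- exact: is_inverse_stretch.
Qed.

(** * Infinite generation *)

(** These are the [N]-smooth numbers. Unlike a bound on the period, smoothness survives repeated
    multiplication by small factors. *)
Definition smooth (N m : nat) : Prop :=
  0 < m /\ forall p, prime p -> p %| m -> p <= N.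

Definition smoothly_periodic (N : nat) (x : Cantor) : Prop :=
  exists m n, smooth N m /\ forall i, n <= i -> x (i + m) = x i.

(** Among [#|S| + 1] positions spaced by the period [m], two carry the same label. There the same
    local action meets the same tail, so [f x] has eventual period [(j - i) * m] with
    [j - i <= #|S|]. *)
Lemma finite_state_smoothly_periodic f : finite_state f ->
  exists K, forall N, K <= N ->
    forall x, smoothly_periodic N x -> smoothly_periodic N (f x).
Proof.
move=> [c d [S [q hq]]]; exists #|S| => N hN x [m [n [[m0 hm] per]]].
(* The summand [c] keeps the truncated subtraction [pos i - c] exact. *)
pose pos (i : nat) := n + c + i * m.
have tail i : shift (pos i) x = shift (pos 0) x.
  elim: i => [|i IH] //; rewrite -IH; apply: functional_extensionality => j.
  rewrite /shift -[RHS]per; last by rewrite /pos; lia.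
  by congr (x _); rewrite /pos mulSn; lia.
pose state (i : 'I_#|S|.+1) := q (mkseq x (pos i)).
have [i [j [lt_ij eq_ij]]] : exists i j : 'I_#|S|.+1, i < j /\ state i = state j.
  have /injectivePn [i [j ne e]] : ~~ injectiveb state.
    apply/negP => /injectiveP /leq_card; rewrite card_ord; lia.
  case: (ltngtP i j) => h; [by exists i, j | by exists j, i | ].
  by move: ne; rewrite (val_inj h) eqxx.
exists ((j - i) * m), (pos i - c); split.
  split; first by rewrite muln_gt0 subn_gt0 lt_ij.
  move=> p pp; rewrite Euclid_dvdM // => /orP [/dvdn_leq h|]; last exact: hm.
  by apply: leq_trans hN; have := ltn_ord j; lia.
have rest k : shift (pos k - c) (f x) = local_action c f (mkseq x (pos k)) (shift (pos 0) x).
  by rewrite /local_action size_mkseq -(tail k) prepend_mkseq.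
have e : shift (pos i - c) (f x) = shift (pos j - c) (f x).
  by rewrite !rest (hq _ _ eq_ij).
move=> t ht; have := congr1 (fun y : Cantor => y (t - (pos i - c))) e.
rewrite /shift subnKC // => ->; congr (f x _).
have -> : pos j = pos i + (j - i) * m.
  by rewrite /pos -[RHS]addnA -mulnDl subnKC // ltnW.
by rewrite /pos in ht *; lia.
Qed.

(** The condition on the inverse gives closure under inversion; [is_homeo] is demanded by
    [is_subgroup]. *)
Definition preserves_smooth (N : nat) (f : Cantor -> Cantor) : Prop :=
  is_homeo f /\ exists2 g, is_inverse f g &
    forall x, smoothly_periodic N x -> smoothly_periodic N (f x) /\ smoothly_periodic N (g x).

Lemma is_homeo_comp f g : is_homeo f -> is_homeo g -> is_homeo (fun x => f (g x)).
Proof.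
have cc k l : ccontinuous k -> ccontinuous l -> ccontinuous (fun x => k (l x)).
  by move=> hk hl x n; have [m hm] := hk (l x) n; have [p hp] := hl x m; exists p => y /hp /hm.
move=> [cf [f' [ff cf']]] [cg [g' [gg cg']]]; split; first exact: cc.
by exists (fun x => g' (f' x)); split; [apply: is_inverse_comp | apply: cc].
Qed.

Lemma preserves_smooth_subgroup N : is_subgroup (preserves_smooth N).
Proof.
split; first by move=> f [].
split.
  split; last by exists (fun x => x).
  by split; [|exists (fun x => x); split]; move=> // x n; exists n.
split=> f g.
  move=> [hf [f' ff pf]] [hg [g' gg pg]]; split; first exact: is_homeo_comp.
  exists (fun x => g' (f' x)); first exact: is_inverse_comp.
  move=> x hx; split; first exact: (pf _ (pg _ hx).1).1.
  exact: (pg _ (pf _ hx).2).2.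
move=> [[cf [f' [ff cf']]] [f'' ff'' pf]] fg.
have eg := is_inverse_unique fg ff; subst g.
split; first by split=> //; exists f; split=> //; apply: is_inverse_sym.
exists f; first exact: is_inverse_sym.
by move=> x /pf [h h']; rewrite (is_inverse_unique ff ff'').
Qed.

Lemma RBL_preserves_smooth f : RBL f -> exists K, forall N, K <= N -> preserves_smooth N f.
Proof.
move=> hf; have [g fg hg] := RBL_inverse hf.
have [K hK] := finite_state_smoothly_periodic (RBL_finite_state hf).
have [K' hK'] := finite_state_smoothly_periodic (RBL_finite_state hg).
exists (K + K') => N hN; split; first by case: hf => [[]].
by exists g => // x hx; split; [apply: hK | apply: hK'] => //; lia.
Qed.

Lemma RBL_not_finitely_generated : ~ finitely_generated RBL.
Proof.
move=> [L [hL gen]].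
have [N hN] : exists N, forall g, List.In g L -> preserves_smooth N g.
  (* Proving the claim for all large [N] lets the bounds of the generators be added in the
     induction. *)
  suff [K hK] : exists K, forall N, K <= N -> forall g, List.In g L -> preserves_smooth N g.
    by exists K; apply: hK.
  elim: L hL {gen} => [|f L IH] hL; first by exists 0.
  have [|K hK] := IH; first by move=> g hg; apply: hL; right.
  have [|K' hK'] := @RBL_preserves_smooth f; first by apply: hL; left.
  by exists (K + K') => N hN g [<-|hg]; [apply: hK' | apply: hK] => //; lia.
have [p ltNp pp] := prime_above N.
(* The image of [zeros] under [xor y] is [y] itself, the indicator of the multiples of [p]. *)
pose y : Cantor := fun i => p %| i.
have hy : RBL (xor y).
  by apply: (@RBL_xor y p 0) => [|i _]; rewrite ?prime_gt0 // /y dvdn_addl.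
have [_ [yi _ pres]] := gen _ hy _ (preserves_smooth_subgroup N) hN.
have /pres [[m [n [[m0 hm] per]]] _] : smoothly_periodic N zeros.
  by exists 1, 0; split=> //; split=> // r /prime_gt1; rewrite dvdn1 => h /eqP e; rewrite e in h.
(* The index [n * p] lies past the preperiod and [y] is 1 there, hence also at [n * p + m]. *)
have : p %| m.
  have le : n <= n * p by rewrite leq_pmulr // prime_gt0.
  have := per _ le; rewrite /xor /zeros !addbF /y dvdn_addr ?dvdn_mull //.
by move=> /(hm _ pp); rewrite leqNgt ltNp.
Qed.

Theorem theorem0p2 :
  is_subgroup RBL /\ simple_group RBL /\ ~ finitely_generated RBL.
Proof.
split; first exact: RBL_subgroup.
by split; [apply: RBL_simple | apply: RBL_not_finitely_generated].
Qed.
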